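(* Let $n \ge 3$ be an integer and let $W_{n+1}$ be the wheel graph on $n+1$ vertices. Then the F-index of the line graph of its subdivision graph is $F(L(S(W_{n+1}))) = n(n^3 + 81)$.
   Context: For a simple graph $H$, $d(u)$ denotes the degree of a vertex $u$ in $H$. The F-index of $H$ is $F(H) = \sum_{u \in V(H)} d^3(u) = \sum_{uv \in E(H)} [d^2(u)+d^2(v)]$. The subdivision graph $S(H)$ is the graph obtained from $H$ by inserting one additional vertex into each edge of $H$ (each edge is replaced by a path of length 2). The line graph $L(H)$ is the simple graph whose vertices are the edges of $H$, two distinct ones being adjacent when they share a common endpoint in $H$. The wheel $W_{n+1}$ on $n+1$ vertices consists of a cycle $C_n$ together with a central vertex joined to all $n$ vertices of the cycle. *)

(* Defs.v *)
From mathcomp Require Import all_boot.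

Set Implicit Arguments.
Unset Strict Implicit.
Unset Printing Implicit Defensive.

Record sgraph := SGraph {
  vertex :> finType;
  adj : rel vertex;
  adj_sym : symmetric adj;
  adj_irr : irreflexive adj }.

Definition degree (G : sgraph) (u : G) : nat := #|[set v : G | adj u v]|.

Definition F_index (G : sgraph) : nat := \sum_(u : G) degree u ^ 3.

(* An edge is the unordered pair of its endpoints. *)
Definition edge_set (G : sgraph) : {set {set G}} :=
  [set e | [exists u, exists v, adj u v && (e == [set u; v])]].

Definition edge (G : sgraph) : finType := {e : {set G} | e \in edge_set G}.

Section Subdivision.
Variable G : sgraph.

(* inr e is the vertex inserted into the edge e. *)
Definition subdiv_adj : rel (G + edge G) := fun x y =>
  match x, y with
  | inl u, inr e | inr e, inl u => u \in val e
  | _, _ => false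
  end.

Lemma subdiv_adj_sym : symmetric subdiv_adj.
Proof. by move=> [u|e] [v|f]. Qed.

Lemma subdiv_adj_irr : irreflexive subdiv_adj.
Proof. by case. Qed.

Definition subdivision : sgraph := SGraph subdiv_adj_sym subdiv_adj_irr.
End Subdivision.

Section LineGraph.
Variable G : sgraph.

Definition line_adj : rel (edge G) := fun e f =>
  (e != f) && [exists u, (u \in val e) && (u \in val f)].

Lemma line_adj_sym : symmetric line_adj.
Proof.
move=> e f; rewrite /line_adj eq_sym; congr (_ && _).
by apply: eq_existsb => u; rewrite andbC.
Qed.

Lemma line_adj_irr : irreflexive line_adj.
Proof. by move=> e; rewrite /line_adj eqxx. Qed.

Definition line_graph : sgraph := SGraph line_adj_sym line_adj_irr.
End LineGraph.

Section Wheel.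
Variable n : nat.

(* The vertices of C_n are 0, ..., n-1; the guard i != j only matters for
   n = 1, where it removes a loop. *)
Definition cycle_adj : rel 'I_n := fun i j =>
  (i != j) && ((j == i.+1 %% n :> nat) || (i == j.+1 %% n :> nat)).

Lemma cycle_adj_sym : symmetric cycle_adj.
Proof. by move=> i j; rewrite /cycle_adj eq_sym orbC. Qed.

Lemma cycle_adj_irr : irreflexive cycle_adj.
Proof. by move=> i; rewrite /cycle_adj eqxx. Qed.

Definition cycle_graph : sgraph := SGraph cycle_adj_sym cycle_adj_irr.

(* None is the central vertex. *)
Definition wheel_adj : rel (option cycle_graph) := fun x y =>
  match x, y with
  | Some i, Some j => adj i j
  | None, None => false
  | _, _ => true
  end.

Lemma wheel_adj_sym : symmetric wheel_adj.
Proof. by move=> [i|] [j|] //=; apply: cycle_adj_sym. Qed.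

Lemma wheel_adj_irr : irreflexive wheel_adj.
Proof. by move=> [i|] //=; apply: cycle_adj_irr. Qed.

(* wheel n has n + 1 vertices: it is the wheel written W_{n+1}. *)
Definition wheel : sgraph := SGraph wheel_adj_sym wheel_adj_irr.
End Wheel.

(* Main.v *)
Require Import Defs.
From mathcomp Require Import all_boot zify.

(** For every graph G, F(L(S(G))) is the sum of the fourth powers of the
    degrees of G ([F_index_line_subdivision]).  Indeed, a vertex of L(S(G)) is
    an edge of S(G), that is a pair (u, e) of a vertex u of G and an edge e of G
    with u in e.  Apart from itself, this edge meets d(u) - 1 edges of S(G) at
    u, and exactly one at the middle vertex of e, because the latter has degree
    2; so it has degree d(u) in L(S(G)) ([degree_line_subdivision]).  As every
    u lies in d(u) such pairs, it contributes d(u) * d(u)^3 to the F-index.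

    In the wheel, the center has degree n and each of the n rim vertices has
    degree 3, whence n^4 + n * 3^4 = n * (n^3 + 81). *)

Lemma edge_setP (G : sgraph) (e : {set G}) :
  reflect (exists u v, adj u v /\ e = [set u; v]) (e \in edge_set G).
Proof.
rewrite inE; apply: (iffP existsP) => [[u /existsP[v /andP[uv /eqP ->]]]|].
  by exists u, v.
by case=> u [v [uv ->]]; exists u; apply/existsP; exists v; rewrite uv eqxx.
Qed.

Lemma adj_neq (G : sgraph) (u v : G) : adj u v -> u != v.
Proof. by apply: contraTneq => ->; rewrite adj_irr. Qed.

Lemma adj_edge (G : sgraph) (u v : G) :
  ([set u; v] \in edge_set G) = adj u v.
Proof.
apply/edge_setP/idP => [[a [b [ab uv]]]|uv]; last by exists u, v.
have nab := adj_neq _ _ _ ab.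
have : (u \in [set a; b]) && (v \in [set a; b]) by rewrite -uv set21 set22.
rewrite !inE => /andP[/orP[] /eqP ua /orP[] /eqP va].
- by case/eqP: nab; have := set22 a b; rewrite -uv ua va !inE orbb => /eqP.
- by rewrite ua va.
- by rewrite ua va adj_sym.
- by case/eqP: nab; have := set21 a b; rewrite -uv ua va !inE orbb => /eqP.
Qed.

Lemma card_edge (G : sgraph) (e : edge G) : #|val e| = 2.
Proof.
by case/edge_setP: (valP e) => u [v [/adj_neq uv ->]]; rewrite cards2 uv.
Qed.

Lemma edge_eq2 (G : sgraph) (e : edge G) (u v : G) :
  u != v -> u \in val e -> v \in val e -> val e = [set u; v].
Proof.
move=> uv ue ve; apply/esym/eqP; rewrite eqEcard cards2 uv card_edge leqnn.
by rewrite andbT; apply/subsetP => w; rewrite !inE => /orP[] /eqP ->.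
Qed.

Definition incident (G : sgraph) (u : G) : {set edge G} :=
  [set e : edge G | u \in val e].

(** Sending a neighbor v of u to [set u; v] is a bijection from the neighbors
    of u to the edges at u. *)
Lemma card_incident (G : sgraph) (u : G) : #|incident G u| = degree u.
Proof.
rewrite /degree -(card_imset _ val_inj).
rewrite -(card_in_imset (f := fun v => [set u; v]) (D := [set v | adj u v])).
  congr #|pred_of_set _|; apply/setP => e; apply/imsetP/imsetP.
    case=> f; rewrite inE => uf ->.
    have [v vf] : exists v, v \in val f :\ u.
      apply/set0Pn; rewrite -card_gt0; have := card_edge _ f.
      by rewrite (cardsD1 u) uf add1n => -[->].
    move: vf; rewrite !inE eq_sym => /andP[uv vf].
    have Ef := edge_eq2 _ _ _ _ uv uf vf.
    by exists v => //; rewrite inE -adj_edge -Ef (valP f).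
  case=> v; rewrite inE -adj_edge => uv ->.
  exists (exist (fun e => e \in edge_set G) _ uv) => //.
  by rewrite inE set21.
move=> v w; rewrite !inE => /adj_neq uv _ /setP /(_ v).
by rewrite !inE eqxx orbT eq_sym (negbTE uv) => /esym /eqP.
Qed.

(** The edges at u and those at v have only e in common, since the graph is
    simple.  The sum of the two degrees thus counts e twice and each neighbor
    of e in the line graph once, whence the shift by 2. *)
Lemma degree_line (G : sgraph) (e : line_graph G) (u v : G) :
  u != v -> u \in val e -> v \in val e ->
  (degree e).+2 = degree u + degree v.
Proof.
move=> uv ue ve; have Ee := edge_eq2 _ _ _ _ uv ue ve.
have EI : incident G u :&: incident G v = [set e].
  apply/setP => f; rewrite !inE; apply/andP/eqP => [[uf vf]|-> //].
  by apply: val_inj; rewrite Ee; apply: edge_eq2.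
have EN : [set f | adj e f] = (incident G u :|: incident G v) :\ e.
  apply/setP => f; rewrite !inE /= /line_adj eq_sym; congr (_ && _).
  apply/existsP/orP => [[w /andP[]]|[uf|vf]].
  - by rewrite Ee !inE => /orP[] /eqP ->; [left|right].
  - by exists u; rewrite ue.
  - by exists v; rewrite ve.
rewrite /degree EN -[in RHS]/(degree u) -[in RHS]/(degree v) -!card_incident.
rewrite -cardsUI EI cards1 addn1 [in RHS](cardsD1 e).
by rewrite !inE ue add1n.
Qed.

Lemma degree_subdivision_old (G : sgraph) (u : G) :
  degree (inl u : subdivision G) = degree u.
Proof.
rewrite -[RHS]card_incident -(card_imset _ (@inr_inj G _)).
rewrite /degree; congr #|pred_of_set _|; apply/setP => -[v|e]; rewrite inE /=.
  by apply/esym/imsetP => -[].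
by rewrite (mem_imset _ _ (@inr_inj _ _)) inE.
Qed.

Lemma degree_subdivision_new (G : sgraph) (e : edge G) :
  degree (inr e : subdivision G) = 2.
Proof.
rewrite -(card_edge _ e) -(card_imset _ (@inl_inj _ (edge G))).
rewrite /degree; congr #|pred_of_set _|; apply/setP => -[v|f]; rewrite inE /=.
  by rewrite (mem_imset _ _ (@inl_inj _ _)).
by apply/esym/imsetP => -[].
Qed.

Lemma edge_subdivision (G : sgraph) (f : edge (subdivision G)) :
  exists u e, val f = [set inl u; inr e].
Proof.
case/edge_setP: (valP f) => -[u|e] [[v|d] [//= _ ->]]; first by exists u, d.
by exists v, e; rewrite setUC.
Qed.

(** The new endpoint of f has degree 2, which cancels exactly the loss of 2 in
    the degree formula for line graphs. *)
Lemma degree_line_subdivision (G : sgraph)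
    (f : line_graph (subdivision G)) (u : G) :
  inl u \in val f -> degree f = degree u.
Proof.
have [v [e Ef]] := edge_subdivision _ f => uf.
have ef : inr e \in val f by rewrite Ef set22.
have := degree_line _ f (inl u) (inr e) isT uf ef.
by rewrite degree_subdivision_old degree_subdivision_new addn2 => -[].
Qed.

Lemma F_index_line_subdivision (G : sgraph) :
  F_index (line_graph (subdivision G)) = \sum_(u : G) degree u ^ 4.
Proof.
(* Double counting of the pairs of an edge f of S(G) and its old endpoint. *)
transitivity (\sum_(f : edge (subdivision G))
                \sum_(u : G | inl u \in val f) degree u ^ 3).
  apply: eq_bigr => f _; have [v [e Ef]] := edge_subdivision _ f.
  have vf : inl v \in val f by rewrite Ef set21.
  rewrite (big_pred1 v) ?(degree_line_subdivision _ _ _ vf) // => u.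
  by rewrite Ef !inE orbF.
rewrite (exchange_big_dep xpredT) //=; apply: eq_bigr => u _.
rewrite sum_nat_const [RHS]expnS; congr (_ * _).
rewrite -degree_subdivision_old -card_incident.
by apply: eq_card => f; rewrite [in RHS]inE.
Qed.

(** The neighbors of i are its cyclic successor and predecessor; they differ
    from each other because n is not 2, and from i because n is not 1. *)
Lemma degree_cycle (n : nat) (i : cycle_graph n) : 3 <= n -> degree i = 2.
Proof.
move=> n3; have i_lt := ltn_ord i.
have val_succ : forall k : 'I_n, k.+1 %% n = if k.+1 == n then 0 else k.+1.
  move=> k; case: eqP => [->|/eqP kn]; first by rewrite modnn.
  by rewrite modn_small // ltn_neqAle kn ltn_ord.
have val_pred : (i + n).-1 %% n = if i == 0 :> nat then n.-1 else i.-1.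
  case: eqP => [->|/eqP i0]; first by rewrite add0n modn_small //; lia.
  have -> : (i + n).-1 = i.-1 + n by lia.
  by rewrite modnDr modn_small //; lia.
have -> : degree i = #|[set ordS i; ord_pred i]|.
  rewrite /degree; congr #|pred_of_set _|; apply/setP => j.
  rewrite !inE /= /cycle_adj -!val_eqE /= val_pred !val_succ.
  have j_lt := ltn_ord j.
  by do !case: eqP => //=; lia.
rewrite cards2 -val_eqE /= val_pred val_succ.
by do !case: eqP => //=; lia.
Qed.

Lemma degree_wheel_center (n : nat) : degree (None : wheel n) = n.
Proof.
rewrite /degree -[RHS]card_ord -cardsT -(card_imset (aT := 'I_n) _ Some_inj).
congr #|pred_of_set _|; apply/setP => -[i|]; rewrite inE /=.
  by rewrite (mem_imset _ _ Some_inj) inE.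
by apply/esym/imsetP => -[].
Qed.

Lemma degree_wheel_rim (n : nat) (i : cycle_graph n) :
  3 <= n -> degree (Some i : wheel n) = 3.
Proof.
move=> /(degree_cycle n i) deg_i; rewrite /degree (cardsD1 None) inE /= add1n.
rewrite -deg_i /degree -(card_imset (aT := 'I_n) _ Some_inj).
congr (#|pred_of_set _|.+1); apply/setP => -[j|]; rewrite !inE /=.
  by rewrite (mem_imset _ _ Some_inj) inE.
by apply/esym/imsetP => -[].
Qed.

Theorem theorem7 (n : nat) (hn : 3 <= n) :
  F_index (line_graph (subdivision (wheel n))) = n * (n ^ 3 + 81).
Proof.
rewrite F_index_line_subdivision (bigD1 None) //= degree_wheel_center.
rewrite mulnDr -expnS; congr (_ + _).
transitivity (\sum_(u : wheel n | u != None) 81).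
  by apply: eq_bigr => -[i|] // _; rewrite degree_wheel_rim.
rewrite sum_nat_const; congr (_ * _).
have -> : #|[pred u : wheel n | u != None]| = #|predC1 (None : wheel n)|.
  by apply: eq_card.
by rewrite cardC1 card_option card_ord.
Qed.
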